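(* Let $R$ be a ring of bounded index. If $R$ is strongly 2-nil-clean, then the matrix ring $M_n(R)$ is 2-nil-clean for all $n\in\mathbb{N}$.
   Context: All rings are associative with identity (not necessarily commutative). $\mathbb{N}$ denotes the set of natural numbers (positive integers), and $M_n(R)$ is the ring of $n\times n$ matrices over $R$. A ring $R$ is 2-nil-clean if every element of $R$ can be written as $e+f+w$ with $e,f\in R$ idempotent and $w\in R$ nilpotent. It is strongly 2-nil-clean if every element can be written in this form with $e,f,w$ pairwise commuting. A ring $R$ is of bounded index if there is a positive integer $k$ such that $a^k=0$ for every nilpotent element $a$ of $R$. *)

(* Defs.v *)
From mathcomp Require Import all_boot all_algebra.

Set Implicit Arguments.
Unset Strict Implicit.
Unset Printing Implicit Defensive.

Import GRing.Theory.
Local Open Scope ring_scope.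

Definition idempotent (R : pzRingType) (e : R) : Prop := e * e = e.

Definition nilpotent (R : pzRingType) (w : R) : Prop :=
  exists k : nat, (0 < k)%N /\ w ^+ k = 0.

Definition bounded_index (R : pzRingType) : Prop :=
  exists k : nat, (0 < k)%N /\ forall a : R, nilpotent a -> a ^+ k = 0.

Definition two_nil_clean (R : pzRingType) : Prop :=
  forall a : R, exists e f w : R,
    [/\ idempotent e, idempotent f, nilpotent w & a = e + f + w].

Definition strongly_two_nil_clean (R : pzRingType) : Prop :=
  forall a : R, exists e f w : R,
    [/\ idempotent e, idempotent f, nilpotent w & a = e + f + w] /\
    [/\ GRing.comm e f, GRing.comm e w & GRing.comm f w].

(* Main.v *)
Require Import Defs.
From mathcomp Require Import all_boot all_algebra.
From HB Require Import structures.
From mathcomp Require Import ring boolp classical_sets.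
Import Defs.

(** The idea is to reduce modulo the Jacobson radical [J] of [R], to decompose
    matrices over [R / J], and to lift the decomposition back.

    In a strongly 2-nil-clean ring every [a ^+ 3 - a] is nilpotent
    ([strongly_two_nil_clean_tripotent]). It follows that [J] is nil and that [R / J]
    is commutative and satisfies [x ^+ 3 = x] ([jacobson_quotient]). The point is that
    [R / J] is reduced: if [x ^+ 2 = 0], then every [r x] is nilpotent, because
    otherwise [R] would contain the matrix units of a 2 x 2 matrix ring, and a
    suitable sum [a] of these has [a ^+ 3 - a] equal to the invertible matrix
    [a ^+ 2] ([square_zero_left_multiple_nilpotent]).

    Over a commutative ring with [x ^+ 3 = x], finitely many elements can be made
    equal to 0, 1 or -1 by cutting the ring with orthogonal idempotents
    ([orthogonal_induction]), which reduces matrices to the fields F_2 and F_3. Over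
    these, cutting off the cyclic subspace of a vector makes a matrix block triangular
    with companion blocks, and a companion block is a shift, which is nilpotent, plus a
    single row that is a sum of two idempotents; only trace 0 in characteristic 3 needs
    a prior change of basis ([small_field_matrix_two_nil_clean]).

    Idempotents lift from matrices over [R / J] to matrices over [R] provided that the
    matrices over [J] form a nil ideal. This is where bounded index enters: by
    Levitzki's argument each matrix [u E_ij] with [u] in [J] lies in every semiprime
    ideal of the matrix ring, and the intersection of these ideals is nil
    ([levitzki], [prime_radical_nil], [matrix_nil_bounded_index]). *)

Set Implicit Arguments.
Unset Strict Implicit.
Unset Printing Implicit Defensive.

Import GRing.Theory.
Local Open Scope ring_scope.

(** * Nilpotent elements and tripotence modulo nilpotents *)

Lemma nilpotentI (R : pzRingType) (x : R) k : x ^+ k = 0 -> nilpotent x.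
Proof. by move=> xk; exists k.+1; rewrite exprS xk mulr0. Qed.

Lemma nilpotent_root (R : pzRingType) (x : R) k : nilpotent (x ^+ k) -> nilpotent x.
Proof. by case=> m [_]; rewrite -exprM; apply: nilpotentI. Qed.

Lemma nilpotentMr (R : pzRingType) (x y : R) :
  GRing.comm x y -> nilpotent x -> nilpotent (x * y).
Proof.
move=> cxy [k [_ xk]]; apply: (@nilpotentI _ _ k).
by rewrite exprMn_comm // xk mul0r.
Qed.

Lemma nilpotentD (R : pzRingType) (x y : R) :
  GRing.comm x y -> nilpotent x -> nilpotent y -> nilpotent (x + y).
Proof.
move=> cxy [k [_ xk]] [l [_ yl]]; apply: (@nilpotentI _ _ (k + l)).
rewrite exprDn_comm //; apply: big1 => i _.
case: (leqP l i) => [li|il].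
  by rewrite -(subnK li) exprD yl !mulr0 mul0rn.
have ki : (k <= k + l - i)%N by rewrite -addnBA ?leq_addr // ltnW.
by rewrite -(subnK ki) exprD xk mulr0 mul0r mul0rn.
Qed.

Lemma comm_add_idempotents (R : pzRingType) (e f : R) :
  idempotent e -> idempotent f -> GRing.comm e f ->
  (e + f) ^+ 2 = e + f + (e * f) *+ 2 /\
  (e + f) * (e * f) = (e * f) *+ 2.
Proof.
move=> ee ff ef; split.
  rewrite expr2 mulrDl !mulrDr ee ff -ef mulr2n.
  by rewrite !addrA -!addrA; congr (_ + _); rewrite addrC -!addrA [_ + (f + _)]addrCA.
by rewrite mulrDl mulrA ee ef mulrA ff -ef.
Qed.

(** Modulo its Jacobson radical, such a ring will turn out to be commutative with
    [x ^+ 3 = x], i.e. a subdirect product of copies of F_2 and F_3. *)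
Definition tripotent_mod_nil (R : pzRingType) := forall a : R, nilpotent (a ^+ 3 - a).

(** If [a = e + f + w] with commuting summands, then [e + f] satisfies
    [s ^+ 3 - s = 6 e f], so that [a ^+ 3 - a] is [6 e f] plus a multiple of [w].
    It remains to see that 6 is nilpotent, and the element 3 gives this: with
    [s = 3 - w] the relation [s (e f) = 2 e f] forces [e f = w (e f)], hence
    [e f = 0], and then [3 ^+ 3 - 3 = 24] is a multiple of [w]. *)
Lemma strongly_two_nil_clean_tripotent (R : pzRingType) :
  strongly_two_nil_clean R -> tripotent_mod_nil R.
Proof.
move=> hs.
have key (a : R) : exists e f w q : R,
  [/\ GRing.comm e f, GRing.comm (e * f) w, nilpotent w & GRing.comm w q] /\
  [/\ GRing.comm (e * f) q, a ^+ 3 - a = (e * f) *+ 6 + w * q,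
      a = e + f + w & (e + f) * (e * f) = (e * f) *+ 2].
  have [e [f [w [[ee ff nw ->] [ef ew fw]]]]] := hs a.
  have [s2 sef] := comm_add_idempotents ee ff ef.
  have csw : GRing.comm (e + f) w by apply/commr_sym/commrD; apply: commr_sym.
  set s := e + f in s2 sef csw *.
  have s3 : s ^+ 3 = s + (e * f) *+ 6.
    by rewrite exprS s2 mulrDr -expr2 s2 mulrnAr sef -mulrnA -addrA -mulrnDr.
  have cas : GRing.comm (s + w) s.
    by apply: commr_sym; apply: commrD => //; apply: commr_refl.
  have := subrXX_comm 3 cas; set q := \sum_(i < 3) _ => qE.
  have efw : GRing.comm (e * f) w by apply/commr_sym/commrM; apply: commr_sym.
  have efs : GRing.comm (e * f) s.
    apply: commrD; apply/commr_sym/commrM => //; by [apply: commr_refl|apply: commr_sym].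
  have cq x : GRing.comm x s -> GRing.comm x w -> GRing.comm x (q - 1).
    move=> xs xw; apply: commrB; last exact: commr1.
    apply: commr_sum => i _; apply: commrM; apply: commrX => //.
    exact: commrD.
  exists e, f, w, (q - 1); split; split => //.
  - by apply: cq => //; apply: commr_sym.
  - exact: cq.
  - have -> : (s + w) ^+ 3 = s ^+ 3 + w * q.
      by rewrite -(subrK (s ^+ 3) ((s + w) ^+ 3)) qE [s + w - s]addrAC subrr add0r addrC.
    by rewrite s3 mulrBr mulr1 opprD addrACA [s + _ - s]addrAC subrr add0r.
have n6 : nilpotent (6%:R : R).
  have [e [f [w [q [[ef efw nw wq] [efq h3 h3' sef]]]]]] := key 3%:R.
  have ef0 : e * f = 0.
    have efE : e * f = w * (e * f).
      have : (3%:R : R) * (e * f) = (e * f) *+ 2 + w * (e * f).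
        by rewrite {1}h3' mulrDl sef.
      by rewrite mulr_natl mulrS addrC; exact: addrI.
    have : forall k, e * f = w ^+ k * (e * f).
      by elim=> [|k IH]; rewrite ?mul1r // exprSr -mulrA -efE.
    by case: nw => k [_ wk] /(_ k); rewrite wk mul0r.
  have n24 : nilpotent (24%:R : R).
    move: h3; rewrite ef0 mul0rn add0r -natrX -natrB // => ->.
    exact: nilpotentMr.
  (* 6 ^ 3 is a multiple of 24 *)
  apply: (@nilpotent_root _ _ 3); rewrite -natrX (_ : 6 ^ 3 = 24 * 9)%N // natrM.
  by apply: nilpotentMr => //; apply: commr_nat.
move=> a; have [e [f [w [q [[ef efw nw wq] [efq -> _ _]]]]]] := key a.
apply: nilpotentD.
- by apply/commr_sym/commrMn/commr_sym/commrM.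
- by rewrite -mulr_natl; apply: nilpotentMr => //; apply/commr_sym/commr_nat.
- exact: nilpotentMr.
Qed.

(** * Lifting idempotents, and square-zero elements *)

(** Identities between polynomials in a single element of a noncommutative ring
    can be checked in the commutative ring of integer polynomials. *)
Lemma int_poly_eval (R : pzRingType) (x : R) : (1 : R) != 0 ->
  exists ev : {rmorphism {poly int} -> R},
    ev 'X = x /\ forall p z, GRing.comm z x -> GRing.comm z (ev p).
Proof.
move=> R1.
pose S : nzRingType := HB.pack R (GRing.PzSemiRing_isNonZero.Build R R1).
have cx : @commr_rmorph int S intr x by move=> a; exact: commr_int.
exists (horner_morph cx : {rmorphism {poly int} -> S}).
split=> [|p z zx]; first exact: (horner_morphX cx).
rewrite /= /horner_morph horner_coef.
apply: commr_sum => i _.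
apply: commrM; last exact: commrX.
by rewrite coef_map; apply: commr_sym; apply/commr_sym/commr_int.
Qed.

(** Newton iteration for the equation [y ^+ 2 = y]: replacing [y] by
    [y + (y ^+ 2 - y) (1 - 2 y)] squares the defect [y ^+ 2 - y], up to a factor. *)
Lemma approximate_idempotent (P : comPzRingType) (x : P) k :
  exists y q h : P, y = x + (x ^+ 2 - x) * q /\ y ^+ 2 - y = (x ^+ 2 - x) ^+ k * h.
Proof.
elim: k => [|k [y [q [h [yE hE]]]]].
  by exists x, 0, (x ^+ 2 - x); rewrite mulr0 addr0 mul1r.
case: k => [|k] in hE *.
  by exists x, 0, 1; rewrite mulr0 addr0 mulr1.
set t := x ^+ 2 - x in yE hE *.
exists (y + (y ^+ 2 - y) * (1 - 2 * y)), (q + t ^+ k * h * (1 - 2 * y)),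
   (t ^+ k * h ^+ 2 * (4 * (y ^+ 2 - y) - 3)); split.
  by rewrite hE {1}yE exprS; ring.
have -> : t ^+ k.+2 * (t ^+ k * h ^+ 2 * (4 * (y ^+ 2 - y) - 3)) =
          (t ^+ k.+1 * h) ^+ 2 * (4 * (y ^+ 2 - y) - 3) by rewrite !exprS; ring.
by rewrite -hE; ring.
Qed.

Lemma lift_idempotent (R : pzRingType) (x : R) : nilpotent (x ^+ 2 - x) ->
  exists e q : R, [/\ idempotent e, e = x + (x ^+ 2 - x) * q &
    forall z, GRing.comm z x -> GRing.comm z q].
Proof.
case=> k [_ xk].
have [R0|R1] := eqVneq (1 : R) 0.
  have all0 (z : R) : z = 0 by rewrite -[z]mulr1 R0 mulr0.
  exists 0, 0; split=> [||z _]; last exact: commr0.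
    by rewrite /idempotent mulr0.
  by rewrite [RHS]all0.
have [ev [evX evC]] := int_poly_eval x R1.
have [y [q [h [yE hE]]]] := approximate_idempotent ('X : {poly int}) k.
have evt : ev ('X ^+ 2 - 'X) = x ^+ 2 - x by rewrite rmorphB rmorphXn /= evX.
exists (ev y), (ev q); split=> [||z]; last exact: evC.
  apply/eqP; rewrite -subr_eq0 -expr2 -rmorphXn -rmorphB hE rmorphM rmorphXn /=.
  by rewrite evt xk mul0r.
by rewrite [in LHS]yE rmorphD rmorphM /= evt evX.
Qed.

(** The identity satisfied by [e] says that on the span of [e] and [e a] right
    multiplication by [a] acts as the invertible matrix [[0,1],[1,1]], whose
    square is one plus itself. There [a ^+ 3 - a] acts as [a ^+ 2], so it cannot
    be nilpotent unless [e = 0]. *)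
Lemma no_matrix_units (R : pzRingType) (e a : R) : nilpotent (a ^+ 3 - a) ->
  e * a ^+ 2 = e * a + e -> e = 0.
Proof.
move=> [k [_ ak]] ea; set z := a ^+ 3 - a in ak.
have ez : e * z = e * a ^+ 2.
  by rewrite /z mulrBr exprSr mulrA ea mulrDl addrK -mulrA -expr2 ea.
have za : GRing.comm a z by apply: commrB; [apply: commrX|]; apply: commr_refl.
have ezk m : e * z ^+ m = e * (a ^+ 2) ^+ m.
  elim: m => [//|m IH]; rewrite exprS mulrA ez -mulrA.
  have -> : a ^+ 2 * z ^+ m = z ^+ m * a ^+ 2.
    by apply/commrX/commr_sym/commrX/commr_sym.
  by rewrite mulrA IH -mulrA -exprSr.
pose h := a ^+ 2 - a.
have eh : e * h = e by rewrite mulrBr ea addrC addKr.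
have ehm m : e * h ^+ m = e by elim: m => [|m IH]; rewrite ?mulr1 // exprS mulrA eh.
have hE : h = a * (a - 1) by rewrite mulrBr mulr1 -expr2.
have ca : GRing.comm a (a - 1) by apply: commrB; [apply: commr_refl|apply: commr1].
rewrite -(ehm (2 * k)%N) hE exprMn_comm // mulrA exprM -ezk ak mulr0 mul0r //.
Qed.

(** If [t = r x] were not nilpotent, [t ^+ 2] would yield a nonzero idempotent
    [e = y x] with [e x = 0]. Then [e], [e y (1 - e)] and [x e] are three of the
    four matrix units of a copy of a 2 x 2 matrix ring, and their sum is an element
    excluded by [no_matrix_units]. *)
Lemma square_zero_left_multiple_nilpotent (R : pzRingType) (x r : R) :
  tripotent_mod_nil R -> x * x = 0 -> nilpotent (r * x).
Proof.
move=> H xx; set t := r * x.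
have ct : GRing.comm t (t ^+ 3 - t).
  by apply: commrB; [apply: commrX|]; apply: commr_refl.
have t2 : (t ^+ 2) ^+ 2 - t ^+ 2 = (t ^+ 3 - t) * t.
  by rewrite mulrBl -exprM -exprSr -expr2.
have ns : nilpotent ((t ^+ 2) ^+ 2 - t ^+ 2).
  by rewrite t2; apply: nilpotentMr; [apply: commr_sym | apply: H].
have [e [q [ee eE qC]]] := lift_idempotent ns.
have tq : GRing.comm t q by apply: qC; apply/commrX/commr_refl.
pose y := (t + (t ^+ 3 - t) * q) * r.
have ey : e = y * x.
  by rewrite eE t2 /y -[RHS]mulrA -/t [RHS]mulrDl -expr2 -[_ * t * q]mulrA tq mulrA.
have ex : e * x = 0 by rewrite ey -mulrA xx mulr0.
have e0 : e = 0.
  apply: (@no_matrix_units _ _ (e + e * y * (1 - e) + x * e)); first exact: H.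
  have ge : (1 - e) * e = 0 by rewrite mulrBl mul1r ee subrr.
  have gxe : (1 - e) * (x * e) = x * e.
    by rewrite mulrBl mul1r [e * (x * e)]mulrA ex mul0r subr0.
  move: (1 - e) ge gxe => g ge gxe.
  set a := e + _ + _.
  have ea : e * a = e + e * y * g.
    by rewrite /a !mulrDr ee !mulrA ee ex mul0r addr0.
  (* here [g] is the complementary idempotent [1 - e] *)
  have ba : e * y * g * a = e.
    have b1 : e * y * g * e = 0 by rewrite -(mulrA (e * y)) ge mulr0.
    have b2 : e * y * g * (e * y * g) = 0.
      by rewrite -(mulrA e y g) (mulrA _ e) (mulrA e y g) b1 mul0r.
    by rewrite !mulrDr b1 b2 !add0r -(mulrA (e * y)) gxe (mulrA (e * y)) -(mulrA e) -ey !ee.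
  by rewrite expr2 mulrA {1}ea mulrDl ba.
have tt : t ^+ 2 = - (((t ^+ 2) ^+ 2 - t ^+ 2) * q).
  by apply/eqP; rewrite -addr_eq0 -eE e0.
apply: (@nilpotent_root _ _ 2); rewrite tt -mulrN; apply: nilpotentMr => //.
apply: commrN; rewrite t2; apply/commr_sym/commrM; apply: commr_sym => //.
by apply: commr_sym; apply: commrB; [apply: commrX|]; apply: commr_sym.
Qed.

(** * Quotient by a two-sided ideal *)

Definition ideal (R : pzRingType) (I : R -> Prop) : Prop :=
  [/\ I 0, forall x y, I x -> I y -> I (x + y),
      forall r x, I x -> I (r * x) & forall r x, I x -> I (x * r)].

Lemma idealN (R : pzRingType) (I : R -> Prop) x : ideal I -> I x -> I (- x).
Proof. by case=> _ _ Il _ Ix; rewrite -mulN1r; exact: Il. Qed.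

Lemma idealB (R : pzRingType) (I : R -> Prop) x y : ideal I -> I x -> I y -> I (x - y).
Proof. by move=> idI Ix Iy; case: (idI) => _ ID _ _; apply: ID => //; exact: idealN. Qed.

(** The ideal is an arbitrary proposition; classical logic turns it into the
    boolean predicate by which the additive group is divided. *)
Section Quotient.
Local Open Scope quotient_scope.
Variables (R : pzRingType) (I : R -> Prop) (idI : ideal I).

Local Definition memI : {pred R} := fun x => `[< I x >].

Local Lemma memI_zmod : zmod_closed memI.
Proof.
split=> [|x y]; rewrite !unfold_in /memI.
  by case: idI => I0 _ _ _; exact/asboolP.
by move=> /asboolP Ix /asboolP Iy; apply/asboolP; exact: idealB.
Qed.

HB.instance Definition _ := GRing.isZmodClosed.Build R memI memI_zmod.

Local Notation Q := (Quotient.quot memI).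

Local Definition mulq : Q -> Q -> Q := fun x y => \pi_Q (repr x * repr y).

Local Lemma pi_eqP x y : (\pi_Q x = \pi_Q y) <-> I (x - y).
Proof.
split=> [/eqP|Ixy]; first by rewrite -Quotient.idealrBE => /asboolP.
by apply/eqP; rewrite -Quotient.idealrBE; apply/asboolP.
Qed.

Local Lemma piM x y : \pi_Q (x * y) = mulq (\pi_Q x) (\pi_Q y).
Proof.
have [_ ID Il Ir] := idI.
have Hx : I (x - repr (\pi_Q x)) by apply/pi_eqP; rewrite reprK.
have Hy : I (y - repr (\pi_Q y)) by apply/pi_eqP; rewrite reprK.
apply/pi_eqP; move: (repr (\pi_Q x)) (repr (\pi_Q y)) Hx Hy => x' y' Hx Hy.
have -> : x * y - x' * y' = (x - x') * y + x' * (y - y').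
  by rewrite mulrBl mulrBr addrA subrK.
by apply: ID; [exact: Ir | exact: Il].
Qed.

Local Lemma mulqA : associative mulq.
Proof.
move=> x y z; rewrite -[x]reprK -[y]reprK -[z]reprK.
by rewrite -(piM (repr x) (repr y)) -(piM (repr y) (repr z)) -!piM mulrA.
Qed.
Local Lemma mul1q : left_id (\pi_Q 1) mulq.
Proof. by move=> x; rewrite -[x]reprK -!piM mul1r. Qed.
Local Lemma mulq1 : right_id (\pi_Q 1) mulq.
Proof. by move=> x; rewrite -[x]reprK -!piM mulr1. Qed.
Local Lemma mulqDl : left_distributive mulq +%R.
Proof.
move=> x y z; rewrite -[x]reprK -[y]reprK -[z]reprK.
by rewrite -!piM -!(raddfD \pi_Q) -piM mulrDl.
Qed.
Local Lemma mulqDr : right_distributive mulq +%R.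
Proof.
move=> x y z; rewrite -[x]reprK -[y]reprK -[z]reprK.
by rewrite -!piM -!(raddfD \pi_Q) -piM mulrDr.
Qed.

Lemma quotient_ring : exists (S : pzRingType) (pi : {rmorphism R -> S}),
  (forall y, exists x, pi x = y) /\ forall x, pi x = 0 <-> I x.
Proof.
pose S : pzRingType := HB.pack Q
  (GRing.Zmodule_isPzRing.Build Q mulqA mul1q mulq1 mulqDl mulqDr).
pose f : R -> S := \pi_Q.
have fM : monoid_morphism f by split => // x y; exact: piM.
have fB : zmod_morphism f by move=> x y; exact: (raddfB \pi_Q).
pose pi : {rmorphism R -> S} := HB.pack f
  (GRing.isZmodMorphism.Build R S f fB) (GRing.isMonoidMorphism.Build R S f fM).
exists S, pi; split=> [y|x]; first by exists (repr y); exact: reprK.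
by rewrite -[0](rmorph0 pi); apply: (iff_trans (pi_eqP x 0)); rewrite subr0.
Qed.
End Quotient.

(** * The Jacobson radical and its quotient *)

(** The Jacobson radical in its elementwise form: every [1 - r x] has a left
    inverse. This form is directly seen to be an ideal. *)
Definition jacobson_radical (R : pzRingType) (x : R) : Prop :=
  forall r, exists s, s * (1 - r * x) = 1.

Lemma jacobson_radical_ideal (R : pzRingType) : ideal (@jacobson_radical R).
Proof.
split=> [r|x y Jx Jy r|a x Jx r|a x Jx r].
- by exists 1; rewrite mulr0 subr0 mulr1.
- have [s sE] := Jx r; have [t tE] := Jy (s * r).
  by exists (t * s); rewrite [r * _]mulrDr opprD addrA -mulrA [s * _]mulrBr sE mulrA.
- by have [s sE] := Jx (r * a); exists s; rewrite mulrA.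
- have [s sE] := Jx (a * r).
  (* the usual inverse of [1 - c a] from that of [1 - a c], with [c = r x] *)
  exists (1 + r * x * s * a).
  rewrite mulrDl mul1r mulrBr mulr1.
  have -> : r * x * s * a * (r * (x * a)) = r * x * (s * (a * r * x)) * a.
    by rewrite !mulrA.
  have -> : s * (a * r * x) = s - 1.
    by rewrite -[in RHS]sE mulrBr mulr1 opprB addrC subrK.
  by rewrite [_ * (s - 1)]mulrBr mulr1 mulrBl subKr !mulrA subrK.
Qed.

Lemma left_inverse_expr (R : pzRingType) (s u : R) k : s * u = 1 -> s ^+ k * u ^+ k = 1.
Proof.
move=> su; elim: k => [|k IH]; first by rewrite mulr1.
by rewrite exprSr exprS mulrA -[_ * s * u]mulrA su mulr1.
Qed.

(** For [x] in the radical [1 - x ^+ 2] has a left inverse, so it can be cancelled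
    from the nilpotent element [x ^+ 3 - x = - (1 - x ^+ 2) x]. *)
Lemma jacobson_radical_nil (R : pzRingType) (x : R) :
  tripotent_mod_nil R -> jacobson_radical x -> nilpotent x.
Proof.
move=> H Jx; have [s sE] := Jx x; have [k [_ xk]] := H x.
apply: (@nilpotentI _ _ k).
have c : GRing.comm (1 - x * x) x.
  apply/commr_sym/commrB; first exact: commr1.
  by apply: commrM; apply: commr_refl.
have E : x ^+ 3 - x = - ((1 - x * x) * x) by rewrite mulrBl mul1r opprB exprSr expr2.
move: xk; rewrite E exprNn exprMn_comm // => /(congr1 (fun z => s ^+ k * ((-1) ^+ k * z))).
by rewrite signrMK !mulr0 mulrA left_inverse_expr // mul1r.
Qed.

Lemma nilpotent_left_inverse (R : pzRingType) (x : R) :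
  nilpotent x -> exists s, s * (1 - x) = 1.
Proof.
case=> k [_ xk]; exists (\sum_(i < k) x ^+ i).
have c : GRing.comm (\sum_(i < k) x ^+ i) (1 - x).
  apply/commr_sym/commr_sum => i _; apply: commrX; apply/commr_sym/commrB.
    exact: commr1.
  exact: commr_refl.
by rewrite c -opprB mulNr -subrX1 xk sub0r opprK.
Qed.

Section Semiprimitive.
Variables (S : pzRingType) (H : tripotent_mod_nil S)
  (J0 : forall x : S, jacobson_radical x -> x = 0).

Lemma semiprimitive_reduced (x : S) : x * x = 0 -> x = 0.
Proof.
move=> xx; apply: J0 => r; apply: nilpotent_left_inverse.
exact: square_zero_left_multiple_nilpotent.
Qed.

Lemma semiprimitive_nilpotent_eq0 (x : S) : nilpotent x -> x = 0.
Proof.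
case=> k [_]; elim/ltn_ind: k x => -[|[|k]] IH x.
- by rewrite expr0 => x1; rewrite -[x]mulr1 x1 mulr0.
- by [].
- move=> xk; apply: (IH k.+1) => //; apply: semiprimitive_reduced.
  by rewrite -exprD addSnnS exprD xk mulr0.
Qed.

Lemma semiprimitive_tripotent (x : S) : x ^+ 3 = x.
Proof. by apply/eqP; rewrite -subr_eq0; apply/eqP/semiprimitive_nilpotent_eq0/H. Qed.

Lemma semiprimitive_expr (x : S) n : x ^+ n.+3 = x ^+ n.+1.
Proof. by rewrite -addn3 exprD semiprimitive_tripotent -exprSr. Qed.

(** Both [e r (1 - e)] and [(1 - e) r e] square to zero. *)
Lemma reduced_idempotent_central (e r : S) : idempotent e -> e * r = r * e.
Proof.
move=> ee.
have eg : e * (1 - e) = 0 by rewrite mulrBr mulr1 ee subrr.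
have ge : (1 - e) * e = 0 by rewrite mulrBl mul1r ee subrr.
have h1 : e * r * (1 - e) = 0.
  by apply: semiprimitive_reduced; rewrite -!mulrA [(1 - e) * (e * _)]mulrA ge mul0r !mulr0.
have h2 : (1 - e) * r * e = 0.
  by apply: semiprimitive_reduced; rewrite -!mulrA [e * ((1 - e) * _)]mulrA eg mul0r !mulr0.
move: h1 h2; rewrite mulrBr mulr1 !mulrBl mul1r => /eqP; rewrite subr_eq0 => /eqP h1.
by move/eqP; rewrite subr_eq0 => /eqP ->.
Qed.

(** Squares are idempotent, hence central. So is [2 x = (x + 1)^2 - x^2 - 1], and
    so is [3 x = - 3 x^2], which follows from expanding [(x + x^2)^3 = x + x^2].
    Hence [x = 3 x - 2 x] is central. *)
Lemma semiprimitive_commutative (x y : S) : x * y = y * x.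
Proof.
have sq z : GRing.comm y (z ^+ 2).
  apply/commr_sym/reduced_idempotent_central.
  by rewrite /idempotent -exprD semiprimitive_expr.
have c2 : GRing.comm y (x *+ 2).
  have -> : x *+ 2 = (x + 1) ^+ 2 - x ^+ 2 - 1.
    by rewrite sqrrD1 addrAC addrK addrC addKr.
  by apply: commrB; [apply: commrB|apply: commr1].
have c3 : x *+ 3 = - (x ^+ 2 *+ 3).
  have := semiprimitive_tripotent (x + x ^+ 2).
  have -> : (x + x ^+ 2) ^+ 3 = x ^+ 3 + (x ^+ 4 *+ 3) + (x ^+ 5 *+ 3) + x ^+ 6.
    rewrite exprDn_comm; last exact/commrX/commr_refl.
    rewrite !big_ord_recr big_ord0 /= add0r !subSS !subn0 -!exprM -!exprD.
    by rewrite !mulr1n addn0 add0n.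
  rewrite !semiprimitive_expr expr1 -!addrA => /eqP.
  rewrite (inj_eq (addrI x)) !addrA -subr_eq0 addrK.
  by rewrite -2!addrA addrC addr_eq0 -[X in - X]addrA => /eqP h; exact: h.
suff yx : GRing.comm y x by rewrite yx.
have -> : x = x *+ 3 - x *+ 2 by rewrite -mulrnBr // mulr1n.
by apply: commrB => //; rewrite c3; apply: commrN; apply: commrMn.
Qed.
End Semiprimitive.

Lemma jacobson_quotient (R : pzRingType) : tripotent_mod_nil R ->
  exists (S : comPzRingType) (pi : {rmorphism R -> S}),
  [/\ forall y, exists x, pi x = y, forall x, pi x = 0 -> jacobson_radical x
    & forall y : S, y ^+ 3 = y].
Proof.
move=> H.
have [S [pi [pi_surj piJ]]] := quotient_ring (jacobson_radical_ideal R).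
have HS : tripotent_mod_nil S.
  move=> y; have [x <-] := pi_surj y; have [k [k0 xk]] := H x.
  by exists k; rewrite -rmorphXn -rmorphB -rmorphXn xk rmorph0.
have J0 (y : S) : jacobson_radical y -> y = 0.
  have [x <-] := pi_surj y => Jx; apply/piJ => r.
  have [s'] := Jx (pi r); have [s <-] := pi_surj s'.
  rewrite -(rmorph1 pi) -rmorphM -rmorphB -rmorphM => /eqP.
  rewrite eq_sym -subr_eq0 -rmorphB => /eqP/piJ /(_ 1) [t].
  rewrite mul1r opprB addrC subrK => tE.
  by exists (t * s); rewrite -mulrA.
pose S' : comPzRingType := HB.pack S
  (GRing.PzRing_hasCommutativeMul.Build S (semiprimitive_commutative HS J0)).
exists S', pi; split=> //; first by move=> x /piJ.
exact: (semiprimitive_tripotent HS J0).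
Qed.

(** * Semiprime ideals and matrices over a nil ideal of bounded index *)

Definition semiprime (R : pzRingType) (I : R -> Prop) : Prop :=
  forall v, (forall r, I (v * r * v)) -> I v.

(** Levitzki's argument that a semiprime ring has no nonzero nil one-sided ideal of
    bounded index, phrased modulo [I]. The exponent is lowered one step at a time:
    put [b = u x] and [v = b^(m-1) u], so that [b v] lies in [I]. For [y = v r]
    the element [b + y] is again of the form [u z], and since [b y] lies in [I]
    only the monomials [y^i b^j] survive in its powers. Multiplying on the right by
    [c = b^(m-2) u] leaves just two of them, and one of these is already in [I];
    the other one says that [v] satisfies the hypothesis with exponent [m - 1].
    By induction [v] lies in [I], which is the hypothesis on [u] with [m - 1]. *)
Lemma levitzki (R : pzRingType) (I : R -> Prop) m (u : R) :
  ideal I -> semiprime I -> (forall x, I ((u * x) ^+ m * u)) -> I u.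
Proof.
move=> idI spI; have [I0 ID Il Ir] := idI.
elim: m u => [|m IH] u Hu; first by move: (Hu 0); rewrite mul1r.
case: m IH Hu => [|m] IH Hu; first by apply: spI => r; exact: Hu.
apply: (IH) => x; set b := u * x; set v := b ^+ m.+1 * u.
have vE : v = u * (x * b ^+ m * u) by rewrite /v exprS /b !mulrA.
apply: IH => r; set y := v * r.
have bv : I (b * v) by rewrite /v mulrA -exprS; exact: Hu.
have bby : I (b * y) by rewrite /y mulrA; exact: Ir.
pose c := b ^+ m * u.
have bc : b * c = v by rewrite /c mulrA -exprS.
have cE : exists z, c = u * z.
  rewrite /c; case: (m) => [|k]; first by exists 1; rewrite mul1r mulr1.
  by exists (x * b ^+ k * u); rewrite exprS /b !mulrA.
have key j : I ((b + y) ^+ j.+1 * c - (y ^+ j * v + y ^+ j.+1 * c)).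
  elim: j => [|j Ij].
    by rewrite !expr1 mul1r mulrDl bc subrr.
  have -> : (b + y) ^+ j.+2 * c - (y ^+ j.+1 * v + y ^+ j.+2 * c) =
     (b + y) * ((b + y) ^+ j.+1 * c - (y ^+ j * v + y ^+ j.+1 * c))
     + (b * (y ^+ j * v) + b * y * (y ^+ j * c)).
    clearbody y v c; rewrite mulrBr mulrA -exprS -addrA; congr (_ + _).
    have yQ : y * (y ^+ j * v + y ^+ j.+1 * c) = y ^+ j.+1 * v + y ^+ j.+2 * c.
      by rewrite mulrDr !mulrA -!exprS.
    have bQ : b * (y ^+ j * v + y ^+ j.+1 * c) = b * (y ^+ j * v) + b * y * (y ^+ j * c).
      by rewrite mulrDr [y ^+ j.+1]exprS !mulrA.
    have cancel (p q : R) : - p = - (q + p) + q by rewrite opprD addrAC addNr add0r.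
    by rewrite mulrDl yQ bQ; exact: cancel.
  apply: (ID); first exact: Il.
  apply: ID; last exact: Ir.
  case: (j) => [|i]; first by rewrite mul1r.
  by rewrite exprS -(mulrA y) mulrA; exact: Ir.
have [z cz] := cE.
have byz : I ((b + y) ^+ m.+2 * c).
  have -> : b + y = u * (x + x * b ^+ m * u * r) by rewrite mulrDr /y vE !mulrA.
  by rewrite cz mulrA; apply: Ir; exact: Hu.
have yc : I (y ^+ m.+2 * c).
  by rewrite cz mulrA; apply: Ir; rewrite /y vE -mulrA; exact: Hu.
rewrite -[_ * v]opprK; apply: idealN => //.
have -> : - (y ^+ m.+1 * v) = ((b + y) ^+ m.+2 * c - (y ^+ m.+1 * v + y ^+ m.+2 * c))
    - ((b + y) ^+ m.+2 * c) + y ^+ m.+2 * c.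
  have cancel (p q t : R) : - p = t - (p + q) - t + q.
    by rewrite [t - _ - t]addrAC subrr add0r opprD addrNK.
  exact: cancel.
by apply: ID => //; apply: idealB.
Qed.

(** If [a] is not nilpotent, an ideal maximal among those that contain no power of
    [a] is semiprime: if [v r v] lies in it for all [r] but [v] does not, then the
    ideal [K] generated by it and [v] contains a power of [a] and has its square
    inside the given ideal. *)
Lemma prime_radical_nil (R : pzRingType) (a : R) :
  (forall I : R -> Prop, ideal I -> semiprime I -> I a) -> nilpotent a.
Proof.
move=> rad_a; have [//|na] := pselect (nilpotent a).
(* The union of the empty chain is empty, so a set [I] stands here for the ideal
   obtained by adjoining 0 to it. *)
pose P (I : set R) := ideal (fun x => x = 0 \/ I x) /\
                      forall k, ~ (a ^+ k = 0 \/ I (a ^+ k)).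
have a_k k : a ^+ k <> 0 by move=> /nilpotentI.
have chain (F : set (set R)) : (F `<=` P)%classic -> total_on F subset ->
    P (\bigcup_(X in F) X)%classic.
  move=> FP Ft; split; last first.
    move=> k [/a_k //|[X FX Xk]].
    by have [_ /(_ k)] := FP X FX; apply; right.
  split; first by left.
  - move=> x y [->|[X FX Xx]]; first by rewrite add0r.
    case=> [->|[Y FY Yy]]; first by rewrite addr0; right; exists X.
    have [Z [FZ XZ YZ]] : exists Z, [/\ F Z, Z x & Z y].
      by have [sXY|sYX] := Ft X Y FX FY; [exists Y | exists X]; split=> //;
        [exact: sXY | exact: sYX].
    have [[_ ID _ _] _] := FP Z FZ.
    have [->|Zxy] := ID x y (or_intror XZ) (or_intror YZ); first by left.
    by right; exists Z.
  - move=> r x [->|[X FX Xx]]; first by left; rewrite mulr0.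
    have [[_ _ Il _] _] := FP X FX.
    by have [->|Xrx] := Il r x (or_intror Xx); [left | right; exists X].
  - move=> r x [->|[X FX Xx]]; first by left; rewrite mul0r.
    have [[_ _ _ Ir] _] := FP X FX.
    by have [->|Xrx] := Ir r x (or_intror Xx); [left | right; exists X].
have [A [[idA Aa] Amax]] := Zorn_bigcup chain.
pose I x := x = 0 \/ A x.
have idI : ideal I := idA.
have [I0 ID Il Ir] := idI.
suff spI : semiprime I by case: (Aa 1%N); rewrite expr1; exact: (rad_a I).
move=> v vIv; have [//|nIv] := pselect (I v); exfalso.
(* [K] is defined as an intersection, so its elements are reached by exhibiting
   ideals that contain [I] and [v]. *)
pose K x := forall L : R -> Prop, ideal L -> (forall z, I z -> L z) -> L v -> L x.
have KI z : I z -> K z by move=> Iz L _ IL _; exact: IL.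
have Kv : K v by move=> L.
have idK : ideal K.
  split=> [L [//]|x y Kx Ky L idL IL Lv|r x Kx L idL IL Lv|r x Kx L idL IL Lv];
  have [L0 LD Ll Lr] := idL.
  - by apply: LD; [exact: Kx | exact: Ky].
  - by apply: Ll; exact: Kx.
  - by apply: Lr; exact: Kx.
have KK x y : K x -> K y -> I (x * y).
  move=> Kx.
  have xv : forall r, I (x * r * v).
    apply: (Kx (fun x => forall r, I (x * r * v))); last exact: vIv.
      split=> [r|p q Ip Iq r|s p Ip r|s p Ip r].
      - by rewrite !mul0r.
      - by rewrite !mulrDl; exact: ID.
      - by rewrite -!mulrA; apply: Il; rewrite mulrA.
      - by rewrite -[p * s * r]mulrA.
    by move=> z Iz r; apply: (Ir); exact: Ir.
  move=> Ky; rewrite -[x]mulr1.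
  apply: (Ky (fun y => forall r, I (x * r * y))); last exact: xv.
    split=> [r|p q Ip Iq r|s p Ip r|s p Ip r].
    - by rewrite mulr0.
    - by rewrite mulrDr; exact: ID.
    - by rewrite mulrA -(mulrA x).
    - by rewrite mulrA; apply: Ir.
  by move=> z Iz r; exact: Il.
have KE x : (x = 0 \/ K x) = K x.
  by apply: propext; split=> [[->|//]|Kx]; [case: idK | right].
have := Amax K; apply.
  split; first by move=> x Ax; apply: KI; right.
  by move=> KA; apply: nIv; right; exact: KA.
split; first by rewrite (_ : (fun x => _) = K) //; apply: funext => x; exact: KE.
by move=> k; rewrite KE => Kk; apply: (Aa (k + k)%N); rewrite exprD; exact: KK.
Qed.

Lemma delta_mx_sandwich (R : pzRingType) n (i j : 'I_n) (a b : R) (Y : 'M[R]_n) :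
  (a *: delta_mx i j) *m Y *m (b *: delta_mx i j) = (a * Y j i * b) *: delta_mx i j.
Proof.
apply/matrixP => p q; rewrite !mxE (bigD1 i) //= big1; last first.
  by move=> s si; rewrite !mxE (negbTE si) !mulr0.
rewrite !mxE (bigD1 j) //= big1; last first.
  by move=> s sj; rewrite !mxE (negbTE sj) !andbF mulr0 mul0r.
by rewrite !mxE !eqxx !addr0 andbT /=; case: (p == i); case: (q == j);
  rewrite ?(mulr1, mulr0, mul0r).
Qed.

(** For [u] in [J] and [U = u E_ij], the product [(U Y)^k U] equals
    [(u Y_ji)^k u E_ij], which vanishes for [k] the nilpotency bound of the base
    ring. By [levitzki] every [u E_ij] lies in all semiprime ideals of the matrix
    ring; so does a matrix over [J], which is therefore nilpotent. *)
Lemma matrix_nil_bounded_index (R : pzRingType) (J : R -> Prop) n (A : 'M[R]_n) :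
  bounded_index R -> ideal J -> (forall x, J x -> nilpotent x) ->
  (forall i j, J (A i j)) -> nilpotent A.
Proof.
move=> [k [_ kP]] [_ _ _ Jr] Jnil JA; apply: prime_radical_nil => I idI spI.
have [I0 ID _ _] := idI.
rewrite [A]matrix_sum_delta.
elim/big_ind: _ => // i _; elim/big_ind: _ => // j _.
apply: (@levitzki _ _ k _ idI spI) => Y.
have uYk m : ((A i j *: delta_mx i j) * Y) ^+ m * (A i j *: delta_mx i j) =
   ((A i j * Y j i) ^+ m * A i j) *: delta_mx i j.
  elim: m => [|m IH]; first by rewrite !mul1r.
  by rewrite exprS -mulrA IH; rewrite [LHS]delta_mx_sandwich exprS !mulrA.
by rewrite uYk kP ?mul0r ?scale0r //; apply: Jnil; exact: Jr.
Qed.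

(** * Companion matrices *)

Definition two_nil_clean_element (R : pzRingType) (a : R) : Prop :=
  exists e f w : R, [/\ idempotent e, idempotent f, nilpotent w & a = e + f + w].

Lemma similar_two_nil_clean (F : comUnitRingType) n (T A B : 'M[F]_n) :
  T \in unitmx -> T *m A = B *m T ->
  two_nil_clean_element B -> two_nil_clean_element A.
Proof.
move=> uT TA [E [G [W [EE GG [k [k0 Wk]] BE]]]].
pose c X := invmx T *m X *m T.
have cM X Y : c X * c Y = c (X * Y).
  by rewrite /c -!mulmxE !mulmxA mulmxK.
have cX X j : (c X) ^+ j = c (X ^+ j).
  elim: j => [|j IH]; first by rewrite /c !expr0 -[1]/(1%:M) mulmx1 mulVmx.
  by rewrite !exprS IH cM.
exists (c E), (c G), (c W); split.
- by rewrite /idempotent cM EE.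
- by rewrite /idempotent cM GG.
- by exists k; split=> //; rewrite cX Wk /c mulmx0 mul0mx.
- rewrite /c -!mulmxDl -!mulmxDr -BE -mulmxA -TA mulKmx //.
Qed.

Section Companion.
Variables (F : comUnitRingType) (d : nat).

Definition shift_mx : 'M[F]_d.+1 := \matrix_(i, j) (j == i.+1 :> nat)%:R.

(** The companion matrix, in the convention of row vectors: the basis is shifted, and
    its last vector is sent to [c]. *)
Definition companion_row (c : 'rV[F]_d.+1) : 'M[F]_d.+1 :=
  shift_mx + delta_mx ord_max 0 *m c.

Lemma shift_mx_nilpotent : nilpotent shift_mx.
Proof.
have E k : forall i j : 'I_d.+1, (shift_mx ^+ k) i j = (j == i + k :> nat)%N%:R.
  elim: k => [|k IH] i j.
    by rewrite expr0 !mxE addn0 -val_eqE eq_sym.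
  rewrite exprS -mulmxE !mxE.
  have [lt_i|ge_i] := ltnP i.+1 d.+1.
    rewrite (bigD1 (Ordinal lt_i)) //= big1 => [|l nl]; last first.
      by rewrite !mxE -val_eqE /= in nl *; rewrite (negbTE nl) mul0r.
    by rewrite !mxE eqxx mul1r addr0 IH /= addSnnS.
  rewrite big1 => [|l _]; last first.
    by rewrite mxE (ltn_eqF (leq_trans (ltn_ord l) ge_i)) mul0r.
  rewrite (_ : _ == _ = false) //; apply: ltn_eqF.
  by apply: leq_trans (ltn_ord j) (leq_trans ge_i _); rewrite addnS ltnS leq_addr.
apply: (@nilpotentI _ _ d.+1); apply/matrixP => i j; rewrite E mxE.
by rewrite (ltn_eqF (leq_trans (ltn_ord j) _)) // leq_addl.
Qed.

(** A matrix with only its last row [c] nonzero acts on the last coordinate by the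
    last entry of [c], which is thus its only possible nonzero eigenvalue. *)
Lemma last_row_idempotent (c : 'rV[F]_d.+1) :
  c 0 ord_max = 1 -> idempotent ((delta_mx ord_max 0 : 'cV_d.+1) *m c : 'M_d.+1).
Proof.
move=> c1; rewrite /idempotent -mulmxE mulmxA -(mulmxA _ c) -colE.
rewrite (_ : col ord_max c = 1%:M) ?mulmx1 //.
by apply/matrixP => i j; rewrite !ord1 !mxE eqxx.
Qed.

Lemma companion_two_nil_clean_1 (c : 'rV[F]_d.+1) :
  c 0 ord_max = 1 -> two_nil_clean_element (companion_row c).
Proof.
move=> c1; exists (delta_mx ord_max 0 *m c), 0, shift_mx; split.
- exact: last_row_idempotent.
- by rewrite /idempotent mulr0.
- exact: shift_mx_nilpotent.
- by rewrite addr0 addrC.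
Qed.

Lemma companion_two_nil_clean_2 (c : 'rV[F]_d.+1) :
  c 0 ord_max = 1 + 1 -> two_nil_clean_element (companion_row c).
Proof.
move=> c2; pose u : 'rV[F]_d.+1 := delta_mx 0 ord_max.
have u1 : u 0 ord_max = 1 by rewrite mxE !eqxx.
exists (delta_mx ord_max 0 *m (c - u)), (delta_mx ord_max 0 *m u), shift_mx; split.
- by apply: last_row_idempotent; rewrite !mxE !eqxx c2 addrK.
- exact: last_row_idempotent.
- exact: shift_mx_nilpotent.
- by rewrite -mulmxDr subrK addrC.
Qed.
End Companion.

(** In trace 0 the companion matrix is first conjugated: in the basis
    [w_0 = e_0], [w_i = e_i - e_(i-1)], described by the rows of [T], it becomes the
    shift plus [E_00] plus a last row whose last entry is [-1]. As [-1 = 1 + 1], that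
    last row splits into two idempotent rows, one of which can be chosen
    orthogonal to [E_00]. *)
Lemma companion_two_nil_clean_0 (F : comUnitRingType) d (c : 'rV[F]_d.+2) :
  (3%:R : F) = 0 -> c 0 ord_max = 0 -> two_nil_clean_element (companion_row c).
Proof.
move=> F3 c0.
pose N := shift_mx F d.+1.
pose T : 'M[F]_d.+2 := 1%:M - N^T.
pose u : 'rV[F]_d.+2 := delta_mx 0 ord_max.
pose x : 'cV[F]_d.+2 := delta_mx ord_max 0.
pose D : 'M[F]_d.+2 := delta_mx 0 0.
have NTN : N^T *m N = 1%:M - D.
  apply/matrixP => i j; rewrite !mxE.
  case: (unliftP ord0 i) => [i'|] ->.
    rewrite (bigD1 (widen_ord (leqnSn _) i')) //= big1 => [|k nk].
      by rewrite !mxE -[_ == j]val_eqE /= /bump /= add1n eqxx mul1r addr0 subr0 eq_sym.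
    rewrite !mxE -val_eqE /= /bump /= add1n eqSS eq_sym in nk *.
    by rewrite (negbTE nk) mul0r.
  rewrite big1 => [|k _]; last by rewrite !mxE mul0r.
  by rewrite eq_sym eqxx subrr.
have NNT : N *m N^T = 1%:M - x *m u.
  apply/matrixP => i j; rewrite !mxE big_ord1 !mxE eqxx andbT.
  have [lt_i|ge_i] := ltnP i.+1 d.+2.
    rewrite (bigD1 (Ordinal lt_i)) //= big1 => [|k nk].
      have ni : (i == ord_max) = false by rewrite -val_eqE; apply/negbTE;
        rewrite neq_ltn -ltnS lt_i.
      by rewrite !mxE eqxx mul1r addr0 ni mul0r subr0 /= eqSS.
    by rewrite !mxE -val_eqE /= in nk *; rewrite (negbTE nk) mul0r.
  have -> : i = ord_max.
    by apply/val_inj/eqP; rewrite eqn_leq -ltnS ltn_ord -ltnS.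
  rewrite big1 => [|k _]; last first.
    by rewrite !mxE (ltn_eqF (ltn_ord k)) mul0r.
  by rewrite eqxx mul1r eq_sym subrr.
have NTx : N^T *m x = 0.
  by rewrite -colE; apply/matrixP => i j; rewrite !mxE (ltn_eqF (ltn_ord i)).
have DNT : D *m N^T = 0.
  apply/matrixP => i j; rewrite !mxE big1 // => k _; rewrite !mxE.
  by case: (eqVneq k 0) => [->|_]; rewrite ?andbF ?mul0r ?mulr0.
have uT : T \in unitmx.
  rewrite unitmxE det_trig.
    by rewrite big1 ?unitr1 // => i _; rewrite !mxE eqxx (ltn_eqF (ltnSn _)) subr0.
  apply/is_trig_mxP => i j ij; rewrite !mxE -val_eqE (ltn_eqF ij).
  by rewrite (ltn_eqF (leqW ij)) subr0.
(* the last row in the new basis, determined by comparing [T C] with [C' T] *)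
pose c' := (c - u) *m invmx T.
have c'x : c' *m x = - 1%:M.
  have <- : T *m x = x by rewrite mulmxBl mul1mx NTx subr0.
  rewrite mulmxA mulmxKV // mulmxBl -!colE; apply/matrixP => i j.
  by rewrite !ord1 !mxE c0 !eqxx sub0r.
have c'm : c' 0 ord_max = - 1.
  by have /matrixP /(_ 0 0) := c'x; rewrite -colE !mxE eqxx.
apply: (@similar_two_nil_clean _ _ T _ (N + D + x *m c')) => //.
  rewrite /companion_row -/N -/x mulmxDr !mulmxDl -[x *m c' *m T]mulmxA mulmxKV //.
  rewrite /T !mulmxBr !mul1mx !mulmx1 !mulNmx NTN NNT DNT [_ *m (x *m c)]mulmxA NTx.
  rewrite mul0mx !subr0.
  by rewrite !opprB !addrA [N + x *m u - 1%:M]addrAC [_ + x *m u + D]addrAC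
       [_ + x *m u + x *m c]addrAC addrK [N - 1%:M + D]addrAC.
have xu : u *m x = 1%:M.
  by rewrite -colE; apply/matrixP => i j; rewrite !ord1 !mxE !eqxx.
have Dx : D *m x = 0.
  by rewrite -colE; apply/matrixP => i j; rewrite !mxE andbF.
have uD : u *m D = 0.
  by rewrite -rowE; apply/matrixP => i j; rewrite !mxE.
exists (x *m (c' - u)), (D + x *m u), N; split.
- apply: last_row_idempotent; rewrite mxE c'm !mxE !eqxx.
  by apply/eqP; rewrite -subr_eq0 -opprD -opprD oppr_eq0 -addrA; apply/eqP; exact: F3.
- rewrite /idempotent -mulmxE mulmxDl !mulmxDr !mulmxA Dx mul0mx addr0.
  by rewrite -!(mulmxA x) uD xu mul_delta_mx mulmx0 add0r -/D mul1mx.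
- exact: shift_mx_nilpotent.
- by rewrite mulmxBr [D + _]addrC addrA subrK -[RHS]addrA [D + N]addrC [LHS]addrC.
Qed.

(** * Matrices over F_2 and F_3 *)

Lemma row_free_extends_to_unit (F : fieldType) d m (K : 'M[F]_(d, d + m)) :
  row_free K -> exists L : 'M[F]_(m, d + m), col_mx K L \in unitmx.
Proof.
move=> Kfree; exists (dsubmx (row_ebase K)).
have KE : K = col_ebase K *m usubmx (row_ebase K).
  rewrite -{1}(mulmx_ebase K) (eqP Kfree) -mulmxA; congr (_ *m _).
  rewrite -[in LHS](vsubmxK (row_ebase K)) (_ : pid_mx d = row_mx 1%:M 0).
    by rewrite mul_row_col mul1mx mul0mx addr0.
  by rewrite pid_mx_row.
have -> : col_mx K (dsubmx (row_ebase K)) =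
    block_mx (col_ebase K) 0 0 1%:M *m row_ebase K.
  by rewrite -[X in _ = _ *m X]vsubmxK mul_block_col -KE mul0mx addr0 mul0mx add0r mul1mx.
rewrite unitmx_mul row_ebase_unit andbT unitmxE det_lblock det1 mulr1 -unitmxE.
exact: col_ebase_unit.
Qed.

Lemma block_triangular_nilpotent (R : pzRingType) d m (W1 : 'M[R]_d) (X : 'M[R]_(m, d))
    (W2 : 'M[R]_m) : nilpotent W1 -> nilpotent W2 ->
  nilpotent (block_mx W1 0 X W2 : 'M_(d + m)).
Proof.
move=> [k [_ k1]] [l [_ l2]].
have E j : exists Y, (block_mx W1 0 X W2 : 'M_(d + m)) ^+ j = block_mx (W1 ^+ j) 0 Y (W2 ^+ j).
  elim: j => [|j [Y IH]].
    by exists 0; rewrite !expr0 -scalar_mx_block.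
  exists (X *m W1 ^+ j + W2 *m Y); rewrite exprS IH -mulmxE mulmx_block.
  by rewrite !mul0mx !mulmx0 addr0 addr0 add0r !mulmxE -!exprS.
have [Y YE] := E (k + l)%N.
have := YE; rewrite !exprD k1 l2 mul0r mulr0 -exprD => kl.
apply: (@nilpotent_root _ _ (k + l)); apply: (@nilpotentI _ _ 2).
by rewrite expr2 kl -mulmxE mulmx_block !mul0mx !mulmx0 !addr0 block_mx0.
Qed.

(** In a basis adapted to the invariant row space of [K] the matrix is block
    triangular. The off-diagonal block can be put entirely into the nilpotent part,
    so that decompositions of the two diagonal blocks suffice. *)
Lemma invariant_subspace_two_nil_clean (F : fieldType) d m (A : 'M[F]_(d + m))
    (K : 'M[F]_(d, d + m)) (C : 'M[F]_d) :
  row_free K -> K *m A = C *m K -> two_nil_clean_element C ->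
  (forall B : 'M[F]_m, two_nil_clean_element B) -> two_nil_clean_element A.
Proof.
move=> Kfree KA [E1 [F1 [W1 [EE1 FF1 WW1 CE]]]] IH.
have [L uP] := row_free_extends_to_unit Kfree.
set P := col_mx K L in uP.
pose M : 'M[F]_(d + m) := P *m A *m invmx P.
have [E2 [F2 [W2 [EE2 FF2 WW2 BE]]]] := IH (drsubmx M).
apply: (similar_two_nil_clean uP (B := M)); first by rewrite /M mulmxKV.
have MK : M = block_mx C 0 (dlsubmx M) (drsubmx M).
  rewrite -[LHS]submxK -[ulsubmx M]/(lsubmx (usubmx M)) -[ursubmx M]/(rsubmx (usubmx M)).
  suff -> : usubmx M = row_mx C 0 by rewrite row_mxKl row_mxKr.
  rewrite /M -!mul_usub_mx col_mxKu KA.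
  have -> : C *m K = row_mx C 0 *m P by rewrite mul_row_col mul0mx addr0.
  by rewrite mulmxK.
exists (block_mx E1 0 0 E2), (block_mx F1 0 0 F2), (block_mx W1 0 (dlsubmx M) W2); split.
- by rewrite /idempotent -mulmxE mulmx_block !mul0mx !mulmx0 !addr0 add0r !mulmxE EE1 EE2.
- by rewrite /idempotent -mulmxE mulmx_block !mul0mx !mulmx0 !addr0 add0r !mulmxE FF1 FF2.
- exact: block_triangular_nilpotent.
- by rewrite {1}MK !add_block_mx !addr0 add0r -CE -BE.
Qed.

(** The vectors [v A^i] are independent up to some index [d], the first one at which
    [v A^(d+1)] depends on the previous ones; they span the cyclic subspace of [v],
    on which [A] acts by a companion matrix. *)
Lemma cyclic_subspace (F : fieldType) n (A : 'M[F]_n) (v : 'rV[F]_n) : v != 0 ->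
  exists d, exists2 K : 'M[F]_(d.+1, n), row_free K &
    exists c, K *m A = companion_row c *m K.
Proof.
move=> v0; pose K m : 'M[F]_(m, n) := \matrix_(i < m) (v *m A ^+ i).
have exm : exists m, ~~ row_free (K m).
  by exists n.+1; rewrite /row_free neq_ltn ltnS rank_leq_col.
case: (ex_minnP exm) => -[|[|d]] notfree mini.
- by move: notfree; rewrite /row_free flatmx0 mxrank0.
- case/negP: notfree; apply/inj_row_free => u.
  rewrite mulmx_sum_row big_ord1 rowK expr0 mulmx1 => /eqP.
  rewrite scaler_eq0 (negbTE v0) orbF => /eqP u0.
  by apply/matrixP => i j; rewrite !ord1 u0 mxE.
have Kfree : row_free (K d.+1).
  by apply: contraT => /mini; rewrite ltnn.
exists d; exists (K d.+1) => //.
suff [c cE] : exists c : 'rV_d.+1, v *m A ^+ d.+1 = c *m K d.+1.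
  exists c; apply/row_matrixP => i; rewrite row_mul rowK -mulmxA mulmxE -exprSr.
  rewrite /companion_row mulmxDl linearD /= -mulmxA row_mul.
  have [lt_i|ge_i] := ltnP i.+1 d.+1.
    have -> : row i (delta_mx ord_max 0 *m (c *m K d.+1)) = 0.
      rewrite row_mul; apply/matrixP => p q; rewrite mxE big_ord1 !mxE.
      by rewrite -val_eqE /= (@ltn_eqF i d lt_i) mul0r.
    have -> : row i (shift_mx F d) = delta_mx 0 (Ordinal lt_i).
      by apply/rowP => j; rewrite !mxE eqxx.
    by rewrite -rowE rowK addr0.
  have -> : i = ord_max.
    by apply/val_inj/eqP; rewrite eqn_leq -ltnS ltn_ord.
  have -> : row ord_max (shift_mx F d) = 0.
    by apply/rowP => j; rewrite !mxE (ltn_eqF (ltn_ord j)).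
  rewrite mul0mx add0r row_mul cE (_ : row _ _ = 1%:M) ?mul1mx //.
  by apply/matrixP => p q; rewrite !ord1 !mxE !eqxx.
have [u u0 uK] : exists2 u : 'rV_d.+2, u != 0 & u *m K d.+2 = 0.
  move: notfree; rewrite -kermx_eq0 => /rowV0Pn [u /sub_kermxP uK u0].
  by exists u.
pose u' : 'rV_d.+1 := \row_i u 0 (widen_ord (leqnSn _) i).
have uE : u' *m K d.+1 + u 0 ord_max *: (v *m A ^+ d.+1) = 0.
  rewrite -[RHS]uK (mulmx_sum_row u') (mulmx_sum_row u) [RHS]big_ord_recr /=.
  congr (_ + _); last by rewrite rowK.
  by apply: eq_bigr => i _; rewrite !rowK mxE.
have umax : u 0 ord_max != 0.
  apply: (contraNneq _ u0) => um.
  move: (uE); rewrite um scale0r addr0 => /eqP.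
  rewrite -(mul0mx _ (K d.+1)) (inj_eq (row_free_inj Kfree)) => /eqP u'0.
  apply/eqP/rowP => j; rewrite [RHS]mxE.
  have [lt_j|ge_j] := ltnP j d.+1.
    have /rowP /(_ (Ordinal lt_j)) := u'0; rewrite !mxE => <-.
    by congr (u _ _); apply: val_inj.
  by rewrite -um; congr (u _ _); apply/val_inj/eqP; rewrite eqn_leq -ltnS ltn_ord.
exists (- (u 0 ord_max)^-1 *: u'); rewrite scaleNr mulNmx -scalemxAl.
move/eqP: uE; rewrite addr_eq0 => /eqP ->.
by rewrite scalerN opprK scalerA mulVf // scale1r.
Qed.

(** The hypothesis on [F] covers F_2 and F_3 at once. The trace of a companion block
    is the last entry of its last row, and the three possibilities for its value are
    the three cases treated for companion matrices. *)
Lemma small_field_matrix_two_nil_clean (F : fieldType) n :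
  (forall x : F, [\/ x = 1, x = 1 + 1 | x = 0 /\ 3%:R = 0 :> F]) ->
  two_nil_clean 'M[F]_n.
Proof.
move=> F3; elim/ltn_ind: n => -[|n] IH A.
  exists 0, 0, 0; split; rewrite /idempotent ?mulr0 //.
    exact: (@nilpotentI _ _ 1).
  by apply/matrixP => -[].
have v0 : (delta_mx 0 0 : 'rV[F]_n.+1) != 0.
  apply/eqP => /matrixP/(_ 0 0)/eqP; rewrite !mxE !eqxx.
  by rewrite oner_eq0.
have [d [K Kfree [c cE]]] := cyclic_subspace A v0.
have C2 : two_nil_clean_element (companion_row c).
  case: (F3 (c 0 ord_max)) => [||[c0 F0]].
  - exact: companion_two_nil_clean_1.
  - exact: companion_two_nil_clean_2.
  case: d c c0 {K Kfree cE} => [|d] c c0; last exact: companion_two_nil_clean_0.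
  exists 0, 0, 0; split; rewrite /idempotent ?mulr0 //.
    exact: (@nilpotentI _ _ 1).
  apply/matrixP => i j; rewrite !ord1 !mxE big_ord1 [c 0 0](_ : _ = 0).
    by rewrite mulr0 !addr0.
  by rewrite -[RHS]c0; congr (c _ _); apply: val_inj.
have dn : (d.+1 <= n.+1)%N by rewrite -(eqP Kfree) rank_leq_col.
have nE := subnKC dn; move: (n.+1 - d.+1)%N nE => m nE.
have mn : (m < n.+1)%N by rewrite -nE addSn ltnS leq_addl.
move: (n.+1) mn nE IH A {v0} K Kfree cE {dn} => n' mn nE; rewrite -nE in mn *.
move=> IH A K Kfree cE.
by apply: (invariant_subspace_two_nil_clean Kfree cE C2); exact: IH.
Qed.

(** * Matrices over a commutative ring of tripotents *)

Section TripotentSplitting.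
Variables (S : comPzRingType) (tripotent : forall x : S, x ^+ 3 = x).

Let six0 : 6 = 0 :> S.
Proof.
have -> : 6 = 2 ^+ 3 - 2 :> S by ring.
by rewrite tripotent subrr.
Qed.

(** These idempotents cut out the parts on which [x] is 0, 1 and -1. Since 6 = 0, the
    coefficients are determined modulo 2 and modulo 3 separately: [e1] is [x ^+ 2]
    and [e2] is 0 modulo 2, while modulo 3 they are [- (x ^+ 2 + x)] and
    [x - x ^+ 2]. *)
Lemma tripotent_splitting (x : S) : exists e0 e1 e2 : S,
  [/\ e0 * e0 = e0, e1 * e1 = e1, e2 * e2 = e2 & 1 = e0 + (e1 + e2)] /\
  [/\ e0 * (e1 + e2) = 0, e1 * e2 = 0, e0 * x = 0, e1 * x = e1 & e2 * x = - e2].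
Proof.
have x3 : x ^+ 3 - x = 0 by rewrite tripotent subrr.
have x2 : 3 * (x ^+ 2 + x) = 0.
  have -> : 3 * (x ^+ 2 + x) = ((x + 1) ^+ 3 - (x + 1)) - (x ^+ 3 - x) by ring.
  by rewrite x3 tripotent !subrr.
exists (1 - x ^+ 2), (2 * x - x ^+ 2), (2 * x ^+ 2 - 2 * x); split; split.
- transitivity (1 - x ^+ 2 + (x ^+ 3 - x) * x); first by ring.
  by rewrite x3 mul0r addr0.
- transitivity (2 * x - x ^+ 2 + (x ^+ 3 - x) * (x - 4) + 6 * (x ^+ 2 - x)); first by ring.
  by rewrite x3 six0 !mul0r !addr0.
- transitivity (2 * x ^+ 2 - 2 * x + (x ^+ 3 - x) * (4 * x - 8) + 6 * (x ^+ 2 - x)).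
    by ring.
  by rewrite x3 six0 !mul0r !addr0.
- by ring.
- transitivity (- (x ^+ 3 - x) * x); first by ring.
  by rewrite x3 oppr0 mul0r.
- transitivity ((x ^+ 3 - x) * (6 - 2 * x) - 6 * (x ^+ 2 - x)); first by ring.
  by rewrite x3 six0 !mul0r subr0.
- transitivity (- (x ^+ 3 - x)); first by ring.
  by rewrite x3 oppr0.
- transitivity (2 * x - x ^+ 2 - (x ^+ 3 - x) + 3 * (x ^+ 2 + x) - 6 * x); first by ring.
  by rewrite x3 x2 six0 mul0r !subr0 addr0.
- transitivity (- (2 * x ^+ 2 - 2 * x) + 2 * (x ^+ 3 - x)); first by ring.
  by rewrite x3 mulr0 addr0.
Qed.

(** Induction along a decomposition of 1 into orthogonal idempotents: 1 is split by
    the characteristic first, since 6 = 0, and the pieces are then split by each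
    member of the list in turn. *)
Lemma orthogonal_induction (P : S -> Prop) (l : seq S) :
  (forall u v, u * v = 0 -> P u -> P v -> P (u + v)) ->
  (forall u, u * u = u -> u *+ 2 = 0 \/ u *+ 3 = 0 ->
     (forall x, x \in l -> [\/ u * x = 0, u * x = u | u * x = - u]) -> P u) ->
  P 1.
Proof.
move=> PD Pbase.
(* [Q] collects the conditions already achieved, which survive further splitting *)
suff main : forall (Q : S -> Prop) (l : seq S),
    (forall u w, Q u -> Q (u * w)) ->
    (forall u, u * u = u -> Q u ->
      (forall x, x \in l -> [\/ u * x = 0, u * x = u | u * x = - u]) -> P u) ->
    forall u, u * u = u -> Q u -> P u.
  have {}main u : u * u = u -> u *+ 2 = 0 \/ u *+ 3 = 0 -> P u.
    apply: (main (fun u => u *+ 2 = 0 \/ u *+ 3 = 0) l) => // {}u w.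
    by rewrite -!mulrnAl => -[->|->]; rewrite mul0r; auto.
  (* 3 and -2 are orthogonal idempotents because 6 = 0 *)
  have -> : 1 = 3 + - 2 :> S by ring.
  apply: PD.
  - by transitivity (- 6 : S); [ring | rewrite six0 oppr0].
  - apply: main; last by left; transitivity (6 : S); [ring | exact: six0].
    by transitivity (3 + 6 : S); [ring | rewrite six0 addr0].
  - apply: main; last by right; transitivity (- 6 : S); [ring | rewrite six0 oppr0].
    by transitivity (- 2 + 6 : S); [ring | rewrite six0 addr0].
move=> {l Pbase} Q l; elim: l Q => [|x l IH] Q Qmul Pbase u uu Qu.
  by apply: Pbase.
have {}IH v : v * v = v -> Q v -> [\/ v * x = 0, v * x = v | v * x = - v] -> P v.
  move=> vv Qv vx.
  apply: (IH (fun w => Q w /\ [\/ w * x = 0, w * x = w | w * x = - w])) => //.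
    move=> w z [Qw wx]; split; first exact: Qmul.
    by rewrite mulrAC; case: wx => ->; [apply: Or31 | apply: Or32 | apply: Or33];
      rewrite ?mul0r ?mulNr.
  move=> w ww [Qw wx] wl; apply: Pbase => // y; rewrite inE => /orP [/eqP -> //|].
  exact: wl.
have [e0 [e1 [e2 [[ee0 ee1 ee2 E] [o0 o1 x0 x1 x2]]]]] := tripotent_splitting x.
have uE e : e * e = e -> u * e * (u * e) = u * e by move=> ee; rewrite mulrACA uu ee.
rewrite -[u]mulr1 E !mulrDr; apply: (PD).
- by rewrite -mulrDr mulrACA o0 mulr0.
- by apply: IH; [exact: uE | exact: Qmul | apply: Or31; rewrite -mulrA x0 mulr0].
apply: PD.
- by rewrite mulrACA o1 mulr0.
- by apply: IH; [exact: uE | exact: Qmul | apply: Or32; rewrite -mulrA x1].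
- by apply: IH; [exact: uE | exact: Qmul | apply: Or33; rewrite -mulrA x2 mulrN].
Qed.

(** A piece on which the entries of [A] come from the field [F]: the decomposition
    over [F] is transported by [phi], a ring morphism onto its image with unit [u]
    rather than 1. *)
Lemma corner_two_nil_clean (F : fieldType) n (A : 'M[S]_n) (u : S) (phi : F -> S) :
  (forall x : F, [\/ x = 1, x = 1 + 1 | x = 0 /\ 3%:R = 0 :> F]) ->
  u * u = u ->
  {morph phi : a b / a + b} -> {morph phi : a b / a * b} ->
  (forall a, u * phi a = phi a) ->
  (forall i j, exists a, u * A i j = phi a) ->
  exists E G W : 'M[S]_n,
  [/\ idempotent E, idempotent G, nilpotent W & u *: A = E + G + W] /\
  [/\ u *: E = E, u *: G = G & u *: W = W].
Proof.
move=> F3 uu phiD phiM uphi Aphi.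
have phi0 : phi 0 = 0 by apply: (addrI (phi 0)); rewrite -phiD !addr0.
have /fin_all_exists [c cE] : forall ij : 'I_n * 'I_n, exists a, u * A ij.1 ij.2 = phi a.
  by move=> [i j]; exact: Aphi.
pose C : 'M[F]_n := \matrix_(i, j) c (i, j).
have [E [G [W [EE GG [k [k0 Wk]] CE]]]] := small_field_matrix_two_nil_clean F3 C.
pose f (X : 'M[F]_n) : 'M[S]_n := map_mx phi X.
have fM X Y : f X * f Y = f (X * Y).
  rewrite -!mulmxE; apply/matrixP => i j; rewrite !mxE (big_morph phi phiD phi0).
  by apply: eq_bigr => l _; rewrite !mxE phiM.
have fD X Y : f (X + Y) = f X + f Y by apply/matrixP => i j; rewrite !mxE phiD.
have uf X : u *: f X = f X by apply/matrixP => i j; rewrite !mxE uphi.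
have fX X m : f X ^+ m.+1 = f (X ^+ m.+1).
  by elim: m => // m IH; rewrite exprS IH fM -exprS.
exists (f E), (f G), (f W); split; split => //.
- by rewrite /idempotent fM EE.
- by rewrite /idempotent fM GG.
- exists k; split=> //; case: k k0 Wk => // k _ Wk.
  by rewrite fX Wk; apply/matrixP => i j; rewrite !mxE phi0.
- by rewrite -!fD -CE; apply/matrixP => i j; rewrite !mxE (cE (i, j)).
Qed.

Lemma Fp_scale_morph p (u : S) : prime p -> u * u = u -> u *+ p = 0 ->
  {morph (fun a : 'F_p => u *+ a) : a b / a + b} /\
  {morph (fun a : 'F_p => u *+ a) : a b / a * b}.
Proof.
move=> p_pr uu up.
have umod m : u *+ (m %% p) = u *+ m.
  by rewrite [in RHS](divn_eq m p) mulrnDr mulnC mulrnA up mul0rn add0r.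
have umodF m : u *+ (m %% (Zp_trunc (pdiv p)).+2) = u *+ m by rewrite Fp_cast.
split=> a b; rewrite umodF; first by rewrite mulrnDr.
by rewrite mulrnAr mulrnAl uu mulrnA.
Qed.

Lemma tripotent_matrix_two_nil_clean n : two_nil_clean 'M[S]_n.
Proof.
move=> A.
pose P (u : S) := exists E G W : 'M[S]_n,
  [/\ idempotent E, idempotent G, nilpotent W & u *: A = E + G + W] /\
  [/\ u *: E = E, u *: G = G & u *: W = W].
suff [E [G [W [[EE GG WW AE] _]]]] : P 1.
  by exists E, G, W; rewrite -AE scale1r.
apply: (@orthogonal_induction _ [seq A ij.1 ij.2 | ij <- enum {: 'I_n * 'I_n}]).
  move=> u v uv [E1 [G1 [W1 [[EE1 GG1 WW1 A1] [uE1 uG1 uW1]]]]].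
  move=> [E2 [G2 [W2 [[EE2 GG2 WW2 A2] [vE2 vG2 vW2]]]]].
  have uvX (X Y : 'M[S]_n) : u *: X = X -> v *: Y = Y -> X * Y = 0 /\ Y * X = 0.
    move=> <- <-; rewrite -!mulmxE -!scalemxAl -!scalemxAr !scalerA.
    by rewrite [v * u]mulrC uv !scale0r.
  have uvY (X : 'M[S]_n) : v *: X = X -> u *: X = 0.
    by move=> <-; rewrite scalerA uv scale0r.
  have uvZ (X : 'M[S]_n) : u *: X = X -> v *: X = 0.
    by move=> <-; rewrite scalerA mulrC uv scale0r.
  exists (E1 + E2), (G1 + G2), (W1 + W2); split; split.
  - have [h1 h2] := uvX _ _ uE1 vE2.
    by rewrite /idempotent mulrDl !mulrDr EE1 EE2 h1 h2 addr0 add0r.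
  - have [h1 h2] := uvX _ _ uG1 vG2.
    by rewrite /idempotent mulrDl !mulrDr GG1 GG2 h1 h2 addr0 add0r.
  - have [h1 h2] := uvX _ _ uW1 vW2.
    by apply: nilpotentD => //; rewrite /GRing.comm h1 h2.
  - by rewrite scalerDl A1 A2 addrACA [E1 + G1 + _]addrACA.
  - by rewrite scalerDl !scalerDr uE1 vE2 (uvY _ vE2) (uvZ _ uE1) addr0 add0r.
  - by rewrite scalerDl !scalerDr uG1 vG2 (uvY _ vG2) (uvZ _ uG1) addr0 add0r.
  - by rewrite scalerDl !scalerDr uW1 vW2 (uvY _ vW2) (uvZ _ uW1) addr0 add0r.
move=> u uu u23 ul.
have uA i j : [\/ u * A i j = 0, u * A i j = u | u * A i j = - u].
  by apply: ul; apply/mapP; exists (i, j) => //; rewrite mem_enum.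
have corner p : prime p -> u *+ p = 0 ->
    (forall x : 'F_p, [\/ x = 1, x = 1 + 1 | x = 0 /\ 3%:R = 0 :> 'F_p]) -> P u.
  move=> p_pr up F3; have [phiD phiM] := Fp_scale_morph p_pr uu up.
  apply: (corner_two_nil_clean F3 uu phiD phiM) => [a|i j].
    by rewrite mulrnAr uu.
  have phi0 : u *+ (0 : 'F_p)%R = 0 by rewrite mulr0n.
  have phi1 : u *+ (1 : 'F_p)%R = u by rewrite mulr1n.
  case: (uA i j) => ->; [exists (0 : 'F_p)%R | exists (1 : 'F_p)%R | exists (- 1 : 'F_p)%R] => //.
  by apply/eqP; rewrite eq_sym -addr_eq0 -[X in _ + X]phi1 -phiD addNr.
case: u23 => [u2|u3].
  apply: (corner 2) => // x.
  case: x => -[|[|]] // i; [apply: Or32 | apply: Or31]; exact: val_inj.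
apply: (corner 3) => // x.
case: x => -[|[|[|]]] // i; [apply: Or33; split | apply: Or31 | apply: Or32]; exact: val_inj.
Qed.
End TripotentSplitting.

(** * Lifting decompositions modulo a nil ideal *)

(** Idempotents lift modulo a nil ideal, and an element whose image is nilpotent is
    itself nilpotent. *)
Lemma lift_two_nil_clean (R S : pzRingType) (pi : {rmorphism R -> S}) :
  (forall y, exists x, pi x = y) -> (forall x, pi x = 0 -> nilpotent x) ->
  two_nil_clean S -> two_nil_clean R.
Proof.
move=> pi_surj ker_nil S2 a.
have lift e : idempotent e -> exists e', idempotent e' /\ pi e' = e.
  move=> ee; have [x xe] := pi_surj e.
  have x0 : pi (x ^+ 2 - x) = 0 by rewrite rmorphB rmorphXn xe expr2 ee subrr.
  have [e' [q [ee' e'E _]]] := lift_idempotent (ker_nil _ x0).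
  by exists e'; split=> //; rewrite e'E rmorphD rmorphM x0 mul0r addr0.
have [e [f [w [ee ff [k [_ wk]] aE]]]] := S2 (pi a).
have [e' [ee' pe]] := lift e ee; have [f' [ff' pf]] := lift f ff.
exists e', f', (a - e' - f'); split=> //;
  last by rewrite -[a - e' - f']addrA -opprD [RHS]addrC subrK.
apply: (@nilpotent_root _ _ k); apply: ker_nil.
by rewrite rmorphXn !rmorphB pe pf aE -addrA -opprD [e + f + w]addrC addrK.
Qed.

Theorem theorem3p8 (R : pzRingType) (hb : bounded_index R)
    (hs : strongly_two_nil_clean R) (n : nat) (hn : (0 < n)%N) :
  two_nil_clean 'M[R]_n.
Proof.
have H := strongly_two_nil_clean_tripotent hs.
have [S [pi [pi_surj pi_ker tripotent]]] := jacobson_quotient H.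
apply: (@lift_two_nil_clean 'M[R]_n 'M[S]_n (map_mx pi)).
- move=> Y.
  have /fin_all_exists [c cE] : forall ij : 'I_n * 'I_n, exists x, pi x = Y ij.1 ij.2.
    by move=> ij; exact: pi_surj.
  by exists (\matrix_(i, j) c (i, j)); apply/matrixP => i j; rewrite !mxE cE.
- move=> X /matrixP X0.
  apply: (matrix_nil_bounded_index hb (@jacobson_radical_ideal R)).
    by move=> x; exact: jacobson_radical_nil.
  by move=> i j; apply: pi_ker; have := X0 i j; rewrite !mxE.
- exact: tripotent_matrix_two_nil_clean.
Qed.
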